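(* Let $p$ be an odd prime, let $q\in\mathbb{C}_p$ with $|1-q|_p<1$, let $\chi$ be a Dirichlet character with conductor $f\in\mathbb{N}$, $f\equiv1\pmod 2$, let $r\in\mathbb{N}$, $w_1,\ldots,w_r\in\mathbb{Z}_p$, $a_1,\ldots,a_r\in\mathbb{Z}$, $n\in\mathbb{Z}_+$ and $x\in\mathbb{Z}_p$. Define $$E_{n,\chi,q}^{(r)}(x\mid w_1,\ldots,w_r;a_1,\ldots,a_r)=\int_X\cdots\int_X[x+w_1x_1+\cdots+w_rx_r]_q^n\Big(\prod_{j=1}^r\chi(x_j)\Big)q^{a_1x_1+\cdots+a_rx_r}\,d\mu_1(x_1)\cdots d\mu_1(x_r).$$ Then $$E_{n,\chi,q}^{(r)}(x\mid w_1,\ldots,w_r;a_1,\ldots,a_r)=2^r\sum_{m_1,\ldots,m_r=0}^{\infty}\Big(\prod_{j=1}^r\chi(m_j)\Big)(-1)^{m_1+\cdots+m_r}q^{a_1m_1+\cdots+a_rm_r}\Big[x+\sum_{j=1}^r w_jm_j\Big]_q^n.$$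
   Context: $\mathbb{C}_p$ is the completion of the algebraic closure of $\mathbb{Q}_p$; $[x]_q=\frac{1-q^x}{1-q}$. $X=\varprojlim_N\mathbb{Z}/fp^N\mathbb{Z}$, and for a uniformly differentiable $g:X\to\mathbb{C}_p$ the fermionic $p$-adic integral is $\int_X g(x)\,d\mu_1(x)=\lim_{N\to\infty}\sum_{x=0}^{fp^N-1}g(x)(-1)^x$; multiple integrals are iterated. $\chi$ is viewed as a function on $X$ via reduction modulo $f$.
   Formalization: The infinite series on the right generally diverges in C_p (e.g. r=1, n=0, f=1, a=0 gives 1-1+1-...); it is read as a regularised sum, iterated in m_1,...,m_r: the value at t=1 of the rational function whose Taylor series is sum c_m t^m. *)

(* Defs.v *)
From HB Require Import structures.
From mathcomp Require Import all_boot all_order all_algebra.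
From mathcomp Require Import all_classical all_reals all_analysis.

Set Implicit Arguments.
Unset Strict Implicit.
Unset Printing Implicit Defensive.

Import Order.TTheory GRing.Theory Num.Theory.
Import numFieldNormedType.Exports.

Local Open Scope classical_set_scope.
Local Open Scope ring_scope.

Definition nonarch_abs (R : realType) (K : fieldType) (v : K -> R) : Prop :=
  [/\ forall x, 0 <= v x,
      forall x, v x = 0 <-> x = 0,
      forall x y, v (x * y) = v x * v y
    & forall x y, v (x + y) <= Num.max (v x) (v y)].

Definition vcvg (R : realType) (K : fieldType) (v : K -> R)
    (u : nat -> K) (l : K) : Prop :=
  v (u n - l) @[n --> \oo] --> (0 : R).

Definition vcauchy (R : realType) (K : fieldType) (v : K -> R)
    (u : nat -> K) : Prop :=
  forall e : R, 0 < e -> exists N : nat,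
    forall m n, (N <= m)%N -> (N <= n)%N -> v (u m - u n) < e.

(* Limits are totalised: the value is 0 when the limit does not exist. *)
Definition vlim (R : realType) (K : fieldType) (v : K -> R)
    (u : nat -> K) : K :=
  xget 0 [set l | vcvg v u l].

(* When K is complete and v p%:R = p^-1, the closure of the prime field rat is
   the completion of rat for the p-adic absolute value. *)
Definition padicQ (R : realType) (K : fieldType) (v : K -> R) : set K :=
  [set x | exists u : nat -> rat, vcvg v (fun n => ratr (u n)) x].

Definition padicZ (R : realType) (K : fieldType) (v : K -> R) : set K :=
  [set x | padicQ v x /\ v x <= 1].

Definition padicQbar (R : realType) (K : fieldType) (v : K -> R) : set K :=
  [set x | exists P : {poly K},
     [/\ P != 0, forall i, padicQ v P`_i & root P x]].

(* (K, v) is a completion of an algebraic closure of Q_p, with |p| = 1/p; this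
   determines (K, v) up to isometric isomorphism.  Characteristic 0 follows
   from v p%:R = p^-1. *)
Record is_Cp (R : realType) (K : fieldType) (v : K -> R) (p : nat) : Prop :=
  IsCp {
    Cp_abs : nonarch_abs v;
    Cp_norm : v p%:R = p%:R^-1;
    Cp_complete : forall u, vcauchy v u -> exists l, vcvg v u l;
    Cp_closed : forall P : {poly K},
      (forall i, padicQbar v P`_i) -> (1 < size P)%N ->
      exists2 x, padicQbar v x & root P x;
    Cp_dense : forall x (e : R), 0 < e ->
      exists2 y, padicQbar v y & v (x - y) < e
  }.

(* For x in Z_p and |1 - q| < 1, q^x is the limit of q^k as the natural number
   k tends p-adically to x. *)
Definition is_qpow (R : realType) (K : fieldType) (v : K -> R)
    (q x y : K) : Prop :=
  forall k : nat -> nat,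
    vcvg v (fun i => (k i)%:R) x -> vcvg v (fun i => q ^+ k i) y.

Definition qpow (R : realType) (K : fieldType) (v : K -> R) (q x : K) : K :=
  xget 0 [set y | is_qpow v q x y].

(* The value at q = 1 is the usual convention [x]_1 = lim_(q -> 1) [x]_q. *)
Definition qnum (R : realType) (K : fieldType) (v : K -> R) (q x : K) : K :=
  if q == 1 then x else (1 - qpow v q x) / (1 - q).

(* A Dirichlet character modulo f, extended by 0 to the integers not prime to
   f, whose conductor is f (that is, which is primitive modulo f). *)
Record dirichlet_conductor (K : fieldType) (f : nat) (chi : int -> K) : Prop :=
  DirichletConductor {
    chi_period : forall m n : int, (m = n %[mod f])%Z -> chi m = chi n;
    chi1 : chi 1 = 1;
    chiM : forall m n : int, chi (m * n) = chi m * chi n;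
    chi_eq0 : forall m : int, chi m = 0 <-> ~~ coprimez m f;
    chi_primitive : forall d : nat, (d %| f)%N ->
      (forall m n : int, coprimez m f -> coprimez n f ->
         (m = n %[mod d])%Z -> chi m = chi n) -> d = f
  }.

(* The inverse limit of the Z/fp^N Z; each residue class is represented by its
   least nonnegative element, which Xcompat enforces. *)
Record padicX (f p : nat) : Type := MkX {
  Xres : nat -> nat;
  Xcompat : forall N, Xres N = (Xres N.+1 %% (f * p ^ N))%N
}.

Lemma natX_compat (f p n N : nat) :
  (n %% (f * p ^ N) = (n %% (f * p ^ N.+1)) %% (f * p ^ N))%N.
Proof. by rewrite modn_dvdm // expnS mulnCA dvdn_mull. Qed.

Definition natX (f p n : nat) : padicX f p := MkX (natX_compat f p n).

(* The projection of padicX f p onto Z_p. *)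
Definition Xval (R : realType) (K : fieldType) (v : K -> R) (f p : nat)
    (y : padicX f p) : K :=
  vlim v (fun N => (Xres y N)%:R).

Definition chiX (K : fieldType) (f p : nat) (chi : int -> K) (y : padicX f p) : K :=
  chi (Xres y 0)%:Z.

Definition is_integralX (R : realType) (K : fieldType) (v : K -> R) (f p : nat)
    (g : padicX f p -> K) (l : K) : Prop :=
  vcvg v (fun N => \sum_(0 <= x < f * p ^ N) g (natX f p x) * (-1) ^+ x) l.

Definition integralX (R : realType) (K : fieldType) (v : K -> R) (f p : nat)
    (g : padicX f p -> K) : K :=
  xget 0 [set l | is_integralX v g l].

(* The terms of sums such as \sum_m chi(m) (-1)^m q^(a m) [x + w m]_q^n do not
   tend to 0 in C_p.  Such a sum is the one obtained from the formal geometric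
   series: the value at t = 1 of the power series \sum_m c m t^m, when this
   series is (the expansion of) a rational function P / D with D(1) != 0.  The
   value does not depend on P and D (is_regsum_unique), and it is the sum of
   the series whenever the latter converges (is_regsum_vcvg). *)
Definition is_regsum (K : fieldType) (c : nat -> K) (s : K) : Prop :=
  exists P D : {poly K},
    [/\ D.[1] != 0,
        forall m, \sum_(k < m.+1) D`_k * c (m - k)%N = P`_m
      & s = P.[1] / D.[1]].

Definition regsum (K : fieldType) (c : nat -> K) : K :=
  xget 0 [set s | is_regsum c s].

(* Iteration of an operator (integral or sum) in r variables; the first
   variable is the innermost one. *)
Fixpoint iter_op (T K : Type) (op : (T -> K) -> K) (r : nat) :
    (r.-tuple T -> K) -> K :=
  match r with
  | 0 => fun g => g [tuple]
  | r'.+1 => fun g =>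
      op (fun y => iter_op op (fun t : r'.-tuple T => g [tuple of rcons t y]))
  end.

(* All the integrals (sums) occurring in iter_op op g exist, where dom h says
   that op h exists. *)
Fixpoint iter_dom (T K : Type) (dom : (T -> K) -> Prop) (op : (T -> K) -> K)
    (r : nat) : (r.-tuple T -> K) -> Prop :=
  match r with
  | 0 => fun _ => True
  | r'.+1 => fun g =>
      (forall y,
         iter_dom dom op (fun t : r'.-tuple T => g [tuple of rcons t y])) /\
      dom (fun y =>
         iter_op op (fun t : r'.-tuple T => g [tuple of rcons t y]))
  end.

Definition multi_integralX (R : realType) (K : fieldType) (v : K -> R)
    (f p r : nat) (g : r.-tuple (padicX f p) -> K) : K :=
  iter_op (@integralX R K v f p) g.

Definition multi_integrableX (R : realType) (K : fieldType) (v : K -> R)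
    (f p r : nat) (g : r.-tuple (padicX f p) -> K) : Prop :=
  iter_dom (fun h => exists l, is_integralX v h l) (@integralX R K v f p) g.

Definition multi_regsum (K : fieldType) (r : nat) (c : r.-tuple nat -> K) : K :=
  iter_op (@regsum K) c.

Definition multi_regsummable (K : fieldType) (r : nat)
    (c : r.-tuple nat -> K) : Prop :=
  iter_dom (fun h => exists s, is_regsum h s) (@regsum K) c.

Definition E_integrand (R : realType) (K : fieldType) (v : K -> R)
    (f p : nat) (q : K) (chi : int -> K) (r n : nat) (x : K)
    (w : 'I_r -> K) (a : 'I_r -> int) (y : r.-tuple (padicX f p)) : K :=
  qnum v q (x + \sum_(j < r) w j * Xval v (tnth y j)) ^+ n
  * (\prod_(j < r) chiX chi (tnth y j))
  * qpow v q (\sum_(j < r) (a j)%:~R * Xval v (tnth y j)).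

Definition E_chi_q (R : realType) (K : fieldType) (v : K -> R)
    (f p : nat) (q : K) (chi : int -> K) (r n : nat) (x : K)
    (w : 'I_r -> K) (a : 'I_r -> int) : K :=
  multi_integralX v (@E_integrand R K v f p q chi r n x w a).

Definition E_summand (R : realType) (K : fieldType) (v : K -> R)
    (q : K) (chi : int -> K) (r n : nat) (x : K)
    (w : 'I_r -> K) (a : 'I_r -> int) (m : r.-tuple nat) : K :=
  (\prod_(j < r) chi (tnth m j)%:Z)
  * (-1) ^+ (\sum_(j < r) tnth m j)%N
  * q ^ (\sum_(j < r) a j * (tnth m j)%:Z)
  * qnum v q (x + \sum_(j < r) w j * (tnth m j)%:R) ^+ n.

Lemma is_regsum_unique (K : fieldType) (c : nat -> K) (s s' : K) :
  is_regsum c s -> is_regsum c s' -> s = s'.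
Proof.
move=> [P [D [D1 DP ->]]] [P' [D' [D'1 DP' ->]]].
suff E : D' * P = D * P'.
  apply/eqP; rewrite eqr_div // mulrC -hornerM E hornerM mulrC.
  by rewrite [X in _ == X]mulrC mulrC.
apply/polyP => m; pose C := \poly_(i < m.+1) c i.
have tr (A B : {poly K}) :
    (forall i, \sum_(k < i.+1) A`_k * c (i - k)%N = B`_i) ->
    forall i, (i <= m)%N -> B`_i = (A * C)`_i.
  move=> AB i im; rewrite -AB coefM; apply: eq_bigr => k _.
  by rewrite coef_poly ltnS (leq_trans (leq_subr _ _) im).
have -> : (D' * P)`_m = (D' * (D * C))`_m.
  rewrite !coefM; apply: eq_bigr => k _.
  by rewrite (tr _ _ DP) // leq_subr.
have -> : (D * P')`_m = (D * (D' * C))`_m.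
  rewrite !coefM; apply: eq_bigr => k _.
  by rewrite (tr _ _ DP') // leq_subr.
by rewrite mulrCA.
Qed.

Lemma vcvgP (R : realType) (K : fieldType) (v : K -> R) (u : nat -> K) (l : K) :
  nonarch_abs v ->
  vcvg v u l <->
  forall e : R, 0 < e -> exists N : nat, forall n, (N <= n)%N -> v (u n - l) < e.
Proof.
move=> [v0 _ _ _]; split.
  move=> /cvgr0Pnorm_lt h e e0; have [N _ hN] := h e e0.
  by exists N => n Nn; have := hN n Nn; rewrite /= ger0_norm.
move=> h; apply/cvgr0Pnorm_lt => e e0; have [N hN] := h e e0.
by exists N => // n Nn /=; rewrite ger0_norm // hN.
Qed.

Lemma vcvg_unique (R : realType) (K : fieldType) (v : K -> R)
    (u : nat -> K) (l l' : K) :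
  nonarch_abs v -> vcvg v u l -> vcvg v u l' -> l = l'.
Proof.
move=> hv /(vcvgP _ _ hv) hl /(vcvgP _ _ hv) hl'.
have [v0 v00 vM vD] := hv.
have v1 : v 1 = 1.
  have : v 1 * v 1 = v 1 * 1 by rewrite -vM !mulr1.
  by apply: mulfI; apply/eqP => /v00 /eqP; rewrite oner_eq0.
have vN x : v (- x) = v x.
  have : v (- 1) ^+ 2 = 1 by rewrite expr2 -vM mulrNN mulr1 v1.
  move=> /eqP; rewrite sqrp_eq1 // => /eqP vN1.
  by rewrite -mulN1r vM vN1 mul1r.
apply/eqP; rewrite -subr_eq0; apply/eqP/v00/eqP.
rewrite eq_le v0 andbT leNgt; apply/negP => e0.
have [N hN] := hl _ e0; have [N' hN'] := hl' _ e0.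
pose n := maxn N N'.
have := vD (u n - l') (- (u n - l)).
rewrite vN opprB addrC addrA subrK leNgt gt_max.
by rewrite hN ?hN' // ?leq_maxl ?leq_maxr.
Qed.

Lemma is_regsum_vcvg (R : realType) (K : fieldType) (v : K -> R)
    (c : nat -> K) (s l : K) :
  nonarch_abs v -> is_regsum c s ->
  vcvg v (fun M => \sum_(0 <= m < M) c m) l -> s = l.
Proof.
move=> hv [P [D [D1 DP ->]]] hl; have [v0 v00 vM vD] := hv.
pose S M := \sum_(0 <= m < M) c m.
have T M : \sum_(0 <= m < M) P`_m = \sum_(0 <= k < M) D`_k * S (M - k)%N.
  elim: M => [|M IH]; first by rewrite !big_nil.
  rewrite !big_nat_recr //= IH -DP subSnn -(big_mkord xpredT
    (fun k => D`_k * c (M - k)%N)) big_nat_recr //= subnn addrA -big_split /=.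
  rewrite {3}/S big_nat1; congr (_ + _).
  apply: eq_big_nat => k /andP[_ kM].
  by rewrite subSn ?(ltnW kM) // /S big_nat_recr //= mulrDr.
have hor (Q : {poly K}) M : (size Q <= M)%N -> Q.[1] = \sum_(0 <= i < M) Q`_i.
  move=> QM; rewrite (horner_coef_wide _ QM) big_mkord.
  by apply: eq_bigr => i _; rewrite expr1n mulr1.
have vS k : vcvg v (fun M => D`_k * S (M - k)%N) (D`_k * l).
  apply/(vcvgP _ _ hv) => e e0.
  have d0 : 0 < v D`_k + 1 by rewrite ltr_wpDl.
  have [N hN] := (vcvgP _ _ hv).1 hl _ (divr_gt0 e0 d0).
  exists (N + k)%N => n Nn; rewrite -mulrBr vM.
  have kn : (k <= n)%N by apply: leq_trans Nn; apply: leq_addl.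
  have /hN : (N <= n - k)%N by rewrite leq_subRL // addnC.
  rewrite ltr_pdivlMr // mulrC => h; apply: le_lt_trans h.
  by rewrite ler_wpM2r // lerDl.
have vsum m : vcvg v (fun M => \sum_(0 <= k < m) D`_k * S (M - k)%N)
                     (\sum_(0 <= k < m) D`_k * l).
  elim: m => [|m IH]; apply/(vcvgP _ _ hv) => e e0.
    by exists 0%N => n _; rewrite !big_nil subrr (v00 0).2.
  have [N hN] := (vcvgP _ _ hv).1 IH _ e0.
  have [N' hN'] := (vcvgP _ _ hv).1 (vS m) _ e0.
  exists (maxn N N') => n; rewrite geq_max => /andP[Nn N'n].
  rewrite !big_nat_recr //= opprD addrACA; apply: le_lt_trans (vD _ _) _.
  by rewrite gt_max hN ?hN'.
have lim1 := vsum (size D).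
rewrite -mulr_suml -(hor _ _ (leqnn _)) in lim1.
apply: (canLR (mulfK D1)); rewrite mulrC.
apply: (vcvg_unique hv _ lim1); apply/(vcvgP _ _ hv) => e e0.
exists (maxn (size D) (size P)) => n; rewrite geq_max => /andP[Dn Pn].
rewrite (hor _ _ Pn) T (big_cat_nat (leq0n _) Dn) //= [X in _ - (_ + X)]big1_seq ?addr0.
  by rewrite subrr (v00 0).2.
move=> k; rewrite mem_index_iota => /andP[_ /andP[Dk _]].
by rewrite nth_default ?mul0r.
Qed.

(* Main.v *)
Require Import Defs.
From mathcomp Require Import all_boot all_order all_algebra.
From mathcomp Require Import all_classical all_reals all_analysis.
From mathcomp Require Import ring.
Import Order.TTheory GRing.Theory Num.Theory.
Local Open Scope ring_scope.

Set Implicit Arguments.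
Unset Strict Implicit.
Unset Printing Implicit Defensive.

(* After expanding the n-th power (binomially in [q^x] and the [q^(w_j x_j)] if
   [q <> 1], multinomially if [q = 1]), the integrand is a finite sum of
   products over j of functions of [x_j] alone, equal on naturals to
   [c m = chi(m) m^k z^m] with [|1 - z| < 1].  This reduces the theorem to one
   variable.  There, for [b m = (-1)^m c m] and [M = f p^N], which is odd, the
   regularised sum S of b satisfies
     [S - (b 0 + ... + b (M - 1)) = sum_m b (m + M) = - sum_m (-1)^m c (m + M)],
   so [b 0 + ... + b (M - 1)] differs from [2 S] by the regularised sum of
   [(-1)^m (c (m + M) - c m)], which is small because [c (m + M) - c m] tends to
   0 uniformly in m while the denominator of the generating function is fixed. *)

(** * Iterated operators and regularised sums *)

Section IteratedOperator.
Variables (T : Type) (K : fieldType).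
Variables (dom : (T -> K) -> Prop) (op : (T -> K) -> K).
Hypothesis op_linear : forall (I : finType) (c : I -> K) (g : I -> T -> K),
  (forall i, dom (g i)) ->
  dom (fun y => \sum_i c i * g i y) /\
  op (fun y => \sum_i c i * g i y) = \sum_i c i * op (g i).

(** Induction on [r]: once the last variable [y] is fixed, the function is again a sum of products
    in the other variables, with coefficients [c i * g i ord_max y]. The inner operators therefore
    leave a linear combination of functions of [y] alone, to which linearity applies. Existence at
    every stage comes along, so no exchange of limits is needed. *)
Lemma iter_op_tensor (r : nat) (I : finType) (c : I -> K)
    (g : I -> 'I_r -> T -> K) :
  (forall i j, dom (g i j)) ->
  iter_dom dom op (fun t : r.-tuple T =>
    \sum_i c i * \prod_(j < r) g i j (tnth t j)) /\
  iter_op op (fun t : r.-tuple T =>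
    \sum_i c i * \prod_(j < r) g i j (tnth t j)) =
  \sum_i c i * \prod_(j < r) op (g i j).
Proof.
elim: r c g => [|r IH] c g dom_g /=.
  by split=> //; apply: eq_bigr => i _; rewrite !big_ord0.
have split_last y : (fun t : r.-tuple T =>
      \sum_i c i * \prod_(j < r.+1) g i j (tnth [tuple of rcons t y] j)) =
    (fun t => \sum_i (c i * g i ord_max y) *
      \prod_(j < r) g i (widen_ord (leqnSn r) j) (tnth t j)).
  apply/funext => t; apply: eq_bigr => i _; rewrite big_ord_recr /= mulrAC -mulrA.
  congr (_ * (_ * _)).
    apply: eq_bigr => j _; congr (g _ _ _).
    rewrite !(tnth_nth (thead [tuple of rcons t y])) /= nth_rcons size_tuple.
    by rewrite ltn_ord.
  congr (g _ _ _); rewrite (tnth_nth y) /= nth_rcons size_tuple ltnn.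
  by rewrite eqxx.
have dom_g' i j : dom (g i (widen_ord (leqnSn r) j)) by [].
have inner y := IH (fun i => c i * g i ord_max y) _ dom_g'.
have -> : (fun y => iter_op op (fun t : r.-tuple T =>
      \sum_i c i * \prod_(j < r.+1) g i j (tnth [tuple of rcons t y] j))) =
    (fun y => \sum_i (c i * \prod_(j < r) op (g i (widen_ord (leqnSn r) j)))
      * g i ord_max y).
  apply/funext => y; rewrite split_last (inner y).2.
  by apply: eq_bigr => i _; rewrite mulrAC.
have [domS opS] := op_linear
  (fun i => c i * \prod_(j < r) op (g i (widen_ord (leqnSn r) j)))
  (fun i => dom_g i ord_max).
split; first by split=> // y; rewrite split_last; exact: (inner y).1.
rewrite opS; apply: eq_bigr => i _.
by rewrite big_ord_recr /= mulrA.
Qed.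

End IteratedOperator.

(** * Formal power series of the form P / D and their values at 1 *)

Section GeneratingFunction.
Variable K : fieldType.
Implicit Types (b c : nat -> K) (D P A : {poly K}).

(** The relation inside [is_regsum]: the power series with coefficients [b] times [D] equals [P]. *)
Definition genfun D b P : Prop :=
  forall m, \sum_(k < m.+1) D`_k * b (m - k)%N = P`_m.

(** Coefficients of a product up to degree [n] only see the truncations at degree [n], so identities
    of power series can be proved in the polynomial ring. *)
Lemma genfunP D b P : genfun D b P <->
  forall n m, (m <= n)%N -> (D * \poly_(i < n.+1) b i)`_m = P`_m.
Proof.
have E n m : (m <= n)%N -> (D * \poly_(i < n.+1) b i)`_m =
    \sum_(k < m.+1) D`_k * b (m - k)%N.
  move=> mn; rewrite coefM; apply: eq_bigr => k _; rewrite coef_poly ltnS.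
  by rewrite (leq_trans (leq_subr _ _) mn).
by split=> [h n m mn|h m]; rewrite -?(h m m (leqnn m)) E.
Qed.

Lemma genfun_mul A D b P : genfun D b P -> genfun (A * D) b (A * P).
Proof.
move=> /genfunP h; apply/genfunP => n m mn; rewrite -mulrA !coefM.
apply: eq_bigr => k _; rewrite h //.
exact: leq_trans (leq_subr _ _) mn.
Qed.

Lemma genfunD D b b' P P' : genfun D b P -> genfun D b' P' ->
  genfun D (fun m => b m + b' m) (P + P').
Proof.
move=> h h' m; rewrite coefD -h -h' -big_split.
by apply: eq_bigr => k _; rewrite mulrDr.
Qed.

Lemma genfunZ a D b P : genfun D b P -> genfun D (fun m => a * b m) (a *: P).
Proof.
by move=> h m; rewrite coefZ -h mulr_sumr; apply: eq_bigr => k _; rewrite mulrCA.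
Qed.

Lemma genfun_poly A D : genfun D (fun m => A`_m) (D * A).
Proof. by move=> m; rewrite coefM. Qed.

Lemma genfun_shift D b P M : genfun D b P ->
  genfun D (fun m => if (m < M)%N then 0 else b (m - M)%N) ('X^M * P).
Proof.
move=> /genfunP h; apply/genfunP => n m mn.
have E i : (i <= n)%N ->
    (\poly_(i < n.+1) (if (i < M)%N then 0 else b (i - M)%N))`_i =
    ('X^M * \poly_(i < n.+1) b i)`_i.
  move=> le_in; rewrite coefXnM !coef_poly ltnS le_in; case: ltnP => // _.
  by rewrite ltnS (leq_trans (leq_subr _ _) le_in).
transitivity (D * ('X^M * \poly_(i < n.+1) b i))`_m.
  rewrite !coefM; apply: eq_bigr => k _.
  by rewrite E // (leq_trans (leq_subr _ _) mn).
rewrite mulrCA !coefXnM; case: ltnP => // _.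
by rewrite h // (leq_trans (leq_subr _ _) mn).
Qed.

(* Applies [X d/dX] to [b = P / D]. *)
Lemma genfun_mulrn D b P : genfun D b P ->
  genfun (D * D) (fun m => m%:R * b m) (D * ('X * P^`()) - 'X * D^`() * P).
Proof.
move=> h.
have coefXd Q m : ('X * Q^`())`_m = m%:R * Q`_m.
  by rewrite coefXM; case: m => [|m]; rewrite ?mul0r //= coef_deriv mulr_natl.
apply/genfunP => n m mn; set B := \poly_(i < _) _.
pose C := \poly_(i < n.+1) b i.
have BE : B = 'X * C^`().
  apply/polyP => i; rewrite coefXd !coef_poly; case: ifP => // _.
  by rewrite mulr0.
have DC k : (k <= n)%N -> (D * C)`_k = P`_k by move=> kn; apply: (genfunP _ _ _).1.
have E : D * D * B = D * ('X * (D * C)^`()) - 'X * D^`() * (D * C).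
  by rewrite BE derivM; ring.
rewrite E !coefB; congr (_ - _); rewrite !coefM; apply: eq_bigr => k _.
  by rewrite !coefXd DC // (leq_trans (leq_subr _ _) mn).
by rewrite DC // (leq_trans (leq_subr _ _) mn).
Qed.

Lemma regsumE c s : is_regsum c s -> regsum c = s.
Proof.
move=> h; apply: is_regsum_unique (h).
exact: (xgetPex 0 (ex_intro _ s h)).
Qed.

Lemma is_regsum0 : is_regsum (fun=> 0 : K) 0.
Proof.
exists 0, 1; rewrite hornerC oner_eq0 horner0 mul0r; split=> // m.
by rewrite coef0 big1 // => k _; rewrite mulr0.
Qed.

Lemma is_regsumD c c' s s' : is_regsum c s -> is_regsum c' s' ->
  is_regsum (fun m => c m + c' m) (s + s').
Proof.
move=> [P [D [D1 DP ->]]] [P' [D' [D'1 DP' ->]]].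
exists (D' * P + D * P'), (D' * D); split.
- by rewrite hornerM mulf_neq0.
- apply: genfunD; first exact: genfun_mul.
  by rewrite mulrC; apply: genfun_mul.
by rewrite hornerD !hornerM; field; rewrite D1.
Qed.

Lemma is_regsumZ a c s : is_regsum c s -> is_regsum (fun m => a * c m) (a * s).
Proof.
move=> [P [D [D1 DP ->]]]; exists (a *: P), D; split=> //.
  exact: genfunZ.
by rewrite hornerZ mulrA.
Qed.

Lemma is_regsum_mulrn c s : is_regsum c s ->
  exists s', is_regsum (fun m => m%:R * c m) s'.
Proof.
move=> [P [D [D1 DP _]]].
exists ((D * ('X * P^`()) - 'X * D^`() * P).[1] / (D * D).[1]).
exists (D * ('X * P^`()) - 'X * D^`() * P), (D * D); split=> //.
  by rewrite hornerM mulf_neq0.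
exact: genfun_mulrn.
Qed.

Lemma regsum_linear (I : finType) (a : I -> K) (c : I -> nat -> K) :
  (forall i, exists s, is_regsum (c i) s) ->
  (exists s, is_regsum (fun m => \sum_i a i * c i m) s) /\
  regsum (fun m => \sum_i a i * c i m) = \sum_i a i * regsum (c i).
Proof.
move=> h.
suff S : is_regsum (fun m => \sum_i a i * c i m) (\sum_i a i * regsum (c i)).
  by split; [exists (\sum_i a i * regsum (c i)) | exact: regsumE].
elim: (index_enum I) => [|i e IH].
  rewrite big_nil; under [X in is_regsum X]funext do rewrite big_nil.
  exact: is_regsum0.
rewrite big_cons; under [X in is_regsum X]funext do rewrite big_cons.
apply: is_regsumD => //; apply: is_regsumZ.
by have [s hs] := h i; rewrite (regsumE hs).
Qed.

(** Multiplying the series by [1 - z X^f] leaves only its first [f] terms, and this denominator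
    takes the value [1 - z] at 1. *)
Lemma is_regsum_geometric (f : nat) (z : K) (c : nat -> K) :
  (0 < f)%N -> 1 - z != 0 -> (forall m, c (m + f)%N = z * c m) ->
  exists s, is_regsum c s.
Proof.
move=> f0 z1 cf; pose D : {poly K} := 1 - z *: 'X^f.
exists ((\poly_(i < f) c i).[1] / D.[1]); exists (\poly_(i < f) c i), D.
split=> //; first by rewrite !hornerE expr1n mulr1.
apply/genfunP => n m mn.
rewrite mulrBl mul1r -scalerAl coefB coefZ coefXnM !coef_poly ltnS mn.
case: ltnP => [|fm]; first by rewrite mulr0 subr0.
by rewrite ltnS (leq_trans (leq_subr _ _) mn) -cf subnK // subrr.
Qed.

End GeneratingFunction.

(** * Non-archimedean limits *)

Lemma expr_small (R : realType) (t e : R) : 0 <= t < 1 -> 0 < e ->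
  exists N, forall n, (N <= n)%N -> t ^+ n < e.
Proof.
move=> /andP[t0 t1] e0.
have /cvgr0Pnorm_lt /(_ _ e0) [N _ hN] : (t ^+ n @[n --> \oo] --> 0)%classic.
  by apply: cvg_expr; rewrite ger0_norm.
by exists N => n Nn; have := hN n Nn; rewrite /= ger0_norm // exprn_ge0.
Qed.

Section AbsoluteValue.
Variables (R : realType) (K : fieldType) (v : K -> R).
Hypothesis hv : nonarch_abs v.
Implicit Types (x y z : K) (u : nat -> K) (e B : R).

Lemma abs_ge0 x : 0 <= v x.
Proof. by have [] := hv. Qed.

Lemma abs_eq0 x : v x = 0 <-> x = 0.
Proof. by have [] := hv. Qed.

Lemma abs0 : v 0 = 0.
Proof. exact/abs_eq0. Qed.

Lemma absM x y : v (x * y) = v x * v y.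
Proof. by have [] := hv. Qed.

Lemma abs_gt0 x : x != 0 -> 0 < v x.
Proof.
move=> /eqP x0; rewrite lt_def abs_ge0 andbT.
by apply/eqP => /abs_eq0.
Qed.

Lemma abs1 : v 1 = 1.
Proof.
apply: (@mulfI _ (v 1)); first by rewrite gt_eqF // abs_gt0 // oner_neq0.
by rewrite -absM !mulr1.
Qed.

Lemma absN x : v (- x) = v x.
Proof.
suff vN1 : v (- 1) = 1 by rewrite -mulN1r absM vN1 mul1r.
apply/eqP; rewrite -sqrp_eq1 ?abs_ge0 //.
by rewrite expr2 -absM mulrNN mulr1 abs1.
Qed.

Lemma absB x y : v (x - y) = v (y - x).
Proof. by rewrite -absN opprB. Qed.

Lemma absX x n : v (x ^+ n) = v x ^+ n.
Proof. by elim: n => [|n IH]; rewrite ?abs1 // !exprS absM IH. Qed.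

Lemma absD_le x y B : v x <= B -> v y <= B -> v (x + y) <= B.
Proof.
move=> xB yB; have [_ _ _ vD] := hv; apply: le_trans (vD x y) _.
by rewrite ge_max xB.
Qed.

Lemma absD_lt x y B : v x < B -> v y < B -> v (x + y) < B.
Proof.
move=> xB yB; have [_ _ _ vD] := hv; apply: le_lt_trans (vD x y) _.
by rewrite gt_max xB.
Qed.

Lemma abs_dist_lt y x z B : v (x - y) < B -> v (y - z) < B -> v (x - z) < B.
Proof. by move=> xy yz; rewrite -(subrKA y); apply: absD_lt. Qed.

Lemma abs_dist_le y x z B : v (x - y) <= B -> v (y - z) <= B -> v (x - z) <= B.
Proof. by move=> xy yz; rewrite -(subrKA y); apply: absD_le. Qed.

Lemma abs_sum_le (I : Type) (s : seq I) (P : pred I) (F : I -> K) B :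
  0 <= B -> (forall i, P i -> v (F i) <= B) -> v (\sum_(i <- s | P i) F i) <= B.
Proof.
by move=> B0 FB; elim/big_ind: _ => //; [rewrite abs0 | move=> *; apply: absD_le].
Qed.

Lemma abs_nat n : v n%:R <= 1.
Proof.
by elim: n => [|n IH]; rewrite ?abs0 // mulrS absD_le // abs1.
Qed.

Lemma abs_dist0 x y : (forall e, 0 < e -> v (x - y) < e) -> x = y.
Proof.
move=> h; apply/eqP; rewrite -subr_eq0; apply/eqP/abs_eq0/eqP.
rewrite eq_le abs_ge0 andbT leNgt; apply/negP => e0.
by have := h _ e0; rewrite ltxx.
Qed.

Lemma abs_le1 x y B : B <= 1 -> v (x - y) < B -> v y <= 1 -> v x <= 1.
Proof.
move=> B1 xy y1; rewrite -(subrK y x) absD_le //.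
exact: le_trans (ltW xy) B1.
Qed.

Lemma abs_le_eq1 x : v (1 - x) < 1 -> v x <= 1.
Proof. by rewrite absB => x1; apply: abs_le1 x1 _; rewrite ?abs1. Qed.

Lemma abs_1unitM x y : v (1 - x) < 1 -> v (1 - y) < 1 -> v (1 - x * y) < 1.
Proof.
move=> x1 y1; have -> : 1 - x * y = (1 - x) + x * (1 - y) by ring.
apply: absD_lt => //; rewrite absM; apply: le_lt_trans y1.
by rewrite ler_piMl ?abs_ge0 // abs_le_eq1.
Qed.

Lemma abs_1unitX x n : v (1 - x) < 1 -> v (1 - x ^+ n) < 1.
Proof.
move=> x1; elim: n => [|n IH]; first by rewrite subrr abs0.
by rewrite exprS abs_1unitM.
Qed.

Lemma absX1_le x n : v x <= 1 -> v (x ^+ n - 1) <= v (x - 1).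
Proof.
move=> x1; rewrite subrX1 absM ler_piMr ?abs_ge0 //.
by apply: abs_sum_le => // i _; rewrite absX exprn_ile1 ?abs_ge0.
Qed.

Lemma vcvg_ext u u' l : u =1 u' -> vcvg v u l -> vcvg v u' l.
Proof. by move=> /funext ->. Qed.

Lemma vcvg_cst x : vcvg v (fun=> x) x.
Proof. by apply/(vcvgP _ _ hv) => e e0; exists 0%N => n _; rewrite subrr abs0. Qed.

Lemma vcvgD u u' l l' : vcvg v u l -> vcvg v u' l' ->
  vcvg v (fun n => u n + u' n) (l + l').
Proof.
move=> /(vcvgP _ _ hv) hu /(vcvgP _ _ hv) hu'; apply/(vcvgP _ _ hv) => e e0.
have [N hN] := hu e e0; have [N' hN'] := hu' e e0.
exists (maxn N N') => n; rewrite geq_max => /andP[Nn N'n].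
by rewrite opprD addrACA absD_lt ?hN ?hN'.
Qed.

Lemma vcvgZ x u l : vcvg v u l -> vcvg v (fun n => x * u n) (x * l).
Proof.
move=> /(vcvgP _ _ hv) hu; apply/(vcvgP _ _ hv) => e e0.
have d0 : 0 < v x + 1 by rewrite ltr_wpDl ?abs_ge0.
have [N hN] := hu _ (divr_gt0 e0 d0); exists N => n /hN.
rewrite ltr_pdivlMr // mulrC -mulrBr absM; apply: le_lt_trans.
by rewrite ler_wpM2r ?abs_ge0 // lerDl.
Qed.

Lemma vlimE u l : vcvg v u l -> vlim v u = l.
Proof.
move=> hu; apply: (vcvg_unique hv _ hu).
exact: (xgetPex 0 (ex_intro _ l hu)).
Qed.

Lemma integralXE (f p : nat) (g : padicX f p -> K) (l : K) :
  is_integralX v g l -> integralX v g = l.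
Proof.
move=> hg; apply: (vcvg_unique hv _ hg).
exact: (xgetPex 0 (ex_intro _ l hg)).
Qed.

Lemma integralX_linear (f p : nat) (I : finType) (a : I -> K)
    (g : I -> padicX f p -> K) :
  (forall i, exists l, is_integralX v (g i) l) ->
  (exists l, is_integralX v (fun t => \sum_i a i * g i t) l) /\
  integralX v (fun t => \sum_i a i * g i t) = \sum_i a i * integralX v (g i).
Proof.
move=> h.
suff S : is_integralX v (fun t => \sum_i a i * g i t)
    (\sum_i a i * integralX v (g i)).
  by split; [exists (\sum_i a i * integralX v (g i)) | exact: integralXE].
rewrite /is_integralX; elim: (index_enum I) => [|i s IH].
  rewrite big_nil; apply: vcvg_ext (vcvg_cst 0) => N.
  by rewrite big1 // => x _; rewrite big_nil mul0r.
rewrite big_cons.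
have Ii : is_integralX v (g i) (integralX v (g i)).
  by have [l hl] := h i; rewrite (integralXE hl).
apply: vcvg_ext (vcvgD (vcvgZ (a i) Ii) IH) => N.
rewrite mulr_sumr -big_split; apply: eq_bigr => x _ /=.
by rewrite big_cons mulrDl mulrA.
Qed.

(* With [b m = (-1)^m c m = P / D] and [M] odd, the polynomial
   [Q = X^M P + P - D * (b 0 + ... + b (M - 1) X^(M - 1))] is [D] times a series
   whose coefficients are 0 or [+-(c (m + M) - c m)]. *)
Lemma is_regsum_integral (c : nat -> K) (M : nat -> nat) (s : K) :
  (forall N, odd (M N)) ->
  (forall e, 0 < e -> exists N0, forall N, (N0 <= N)%N ->
    forall m, v (c (m + M N)%N - c m) < e) ->
  is_regsum (fun m => (-1) ^+ m * c m) s ->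
  vcvg v (fun N => \sum_(0 <= m < M N) c m * (-1) ^+ m) (2 * s).
Proof.
move=> oddM hc [P [D [D1 DP ->]]]; apply/(vcvgP _ _ hv) => e e0.
pose C := \sum_(k < size D) v D`_k.
have C0 : 0 <= C by apply: sumr_ge0 => k _; apply: abs_ge0.
have vD k : v D`_k <= C.
  have [kD|kD] := ltnP k (size D); last by rewrite nth_default // abs0.
  rewrite /C (bigD1 (Ordinal kD)) //= lerDl.
  by apply: sumr_ge0 => i _; apply: abs_ge0.
(* The polynomial [Q] below has coefficients bounded by [C d], hence [|Q(1)| <= C d], while [|Q(1)|]
   is [|D(1)|] times the error to be estimated. This choice of [d] gives [C d < e |D(1)|], strictly
   because of the [+ 1]. *)
have d0 : 0 < e * v D.[1] / (C + 1).
  by rewrite divr_gt0 ?mulr_gt0 ?abs_gt0 // ltr_wpDl.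
have [N0 hN0] := hc _ d0; exists N0 => N /hN0 small.
set d := _ / _ in d0 small.
pose b m := (-1) ^+ m * c m; pose A := \poly_(i < M N) b i.
pose Q := 'X^(M N) * P + P - D * A.
have vQ i : v Q`_i <= C * d.
  have DPb : genfun D b P by [].
  have := genfunD (genfunD (genfun_shift (M N) DPb) DPb)
    (genfunZ (-1) (genfun_poly A D)) i.
  rewrite scaleN1r => <-.
  apply: abs_sum_le => [|k _]; first by rewrite mulr_ge0 // ltW.
  rewrite absM; apply: ler_pM; rewrite ?abs_ge0 //.
  rewrite coef_poly; set j := (i - k)%N; case: ltnP => [|Mj].
    by rewrite mulN1r add0r subrr abs0 ltW.
  rewrite mulr0 addr0 /b -{3 4}(subnK Mj) exprD -[(-1) ^+ M N]signr_odd oddM.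
  rewrite expr1 mulrN1 mulNr -mulrBr absM absX absN abs1 expr1n mul1r.
  by rewrite absB; apply/ltW.
have Q1 : Q.[1] = 2 * P.[1] - D.[1] * \sum_(0 <= m < M N) c m * (-1) ^+ m.
  have A1 : A.[1] = \sum_(0 <= m < M N) c m * (-1) ^+ m.
    rewrite horner_poly big_mkord; apply: eq_bigr => m _.
    by rewrite expr1n mulr1 mulrC.
  by rewrite !hornerE expr1n A1; ring.
have : v Q.[1] <= C * d.
  rewrite horner_coef; apply: abs_sum_le => [|i _].
    by rewrite mulr_ge0 // ltW.
  by rewrite expr1n mulr1.
have -> : Q.[1] = - (D.[1] * (\sum_(0 <= m < M N) c m * (-1) ^+ m -
    2 * (P.[1] / D.[1]))) by rewrite Q1; field.
rewrite absN absM => h; rewrite -(ltr_pM2l (abs_gt0 D1)).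
apply: le_lt_trans h _; rewrite /d mulrA ltr_pdivrMr ?ltr_wpDl //.
rewrite [v _ * e]mulrC [C * _]mulrC ltr_pM2l ?ltrDl //.
by rewrite mulr_gt0 // abs_gt0.
Qed.

End AbsoluteValue.

(** * p-adic continuity of chi(m) m^k z^m *)

Section Padic.
Variables (R : realType) (K : fieldType) (v : K -> R) (p : nat).
Hypotheses (hv : nonarch_abs v) (p_prime : prime p) (hp : v p%:R = p%:R^-1).
Implicit Types (x y z q : K) (e : R).

Lemma absp_gt0 : 0 < v p%:R.
Proof. by rewrite hp invr_gt0 ltr0n prime_gt0. Qed.

Lemma absp_lt1 : v p%:R < 1.
Proof. by rewrite hp invf_lt1 ?ltr0n ?ltr1n ?prime_gt0 ?prime_gt1. Qed.

Lemma absp_small e : 0 < e -> exists N, forall n, (N <= n)%N -> v p%:R ^+ n < e.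
Proof. by apply: expr_small; rewrite absp_lt1 ltW ?absp_gt0. Qed.

(** By Bezout, 1 is a combination of [p] and [m]; if both had absolute value below 1, so would 1. *)
Lemma abs_coprime m : coprime p m -> v m%:R = 1.
Proof.
move=> pm; apply/eqP; rewrite eq_le abs_nat //= leNgt; apply/negP => m1.
have := abs1 hv; have [km kn E _] := egcdnP m (prime_gt0 p_prime).
have -> : 1 = km%:R * p%:R - kn%:R * m%:R :> K.
  by rewrite -!natrM E (eqP pm) natrD addrAC subrr add0r.
suff h : v (km%:R * p%:R - kn%:R * m%:R) < 1 by move=> h1; rewrite h1 ltxx in h.
apply: absD_lt; rewrite ?absN // absM //.
  by apply: le_lt_trans absp_lt1; rewrite ler_piMl ?abs_ge0 ?abs_nat.
by apply: le_lt_trans m1; rewrite ler_piMl ?abs_ge0 ?abs_nat.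
Qed.

Lemma dvdn_abs N m : (p ^ N %| m)%N -> v m%:R <= v p%:R ^+ N.
Proof.
move=> /dvdnP[k ->]; rewrite natrM natrX absM // absX //.
by rewrite ler_piMl ?exprn_ge0 ?abs_ge0 ?abs_nat.
Qed.

(** Only the [p]-part of [m] contributes to [v m%:R]. Together with [dvdn_abs], this turns distances
    between natural numbers into divisibility. *)
Lemma abs_dvdn N m : v m%:R <= v p%:R ^+ N -> (p ^ N %| m)%N.
Proof.
have [->|m0] := posnP m; first by rewrite dvdn0.
have [m' pm' ->] := pfactor_coprime p_prime m0.
rewrite natrM natrX absM // absX // abs_coprime // mul1r.
rewrite ler_iXn2l ?absp_gt0 ?absp_lt1 // => Ne.
exact/dvdn_mull/dvdn_exp2l.
Qed.

(** If [m] vanished in [K], its absolute value would be at most [|p|^m], so [p^m] would divide [m],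
    although [m < p^m]. *)
Lemma natr_neq0 m : (0 < m)%N -> m%:R != 0 :> K.
Proof.
move=> m0; apply/eqP => mK; have : v m%:R <= v p%:R ^+ m.
  by rewrite mK abs0 // exprn_ge0 // abs_ge0.
move=> /abs_dvdn /(dvdn_leq m0); rewrite leqNgt => /negP; apply.
exact/ltn_expl/prime_gt1.
Qed.

(** Each [p]-th power gains a factor: [y^p - 1] is [y - 1] times [1 + y + ... + y^(p-1)], and the
    latter is [p] plus the sum of the [y^i - 1], hence bounded by the maximum of [|p|] and [|z - 1|]
    for [y] a power of [z]. *)
Lemma abs_expn_pexp z N : v (1 - z) < 1 ->
  v (z ^+ (p ^ N) - 1) <= Num.max (v p%:R) (v (z - 1)) ^+ N * v (z - 1).
Proof.
move=> z1; have zle := abs_le_eq1 hv z1.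
elim: N => [|N IH]; first by rewrite expn0 expr1 mul1r.
set t := Num.max _ _ in IH *; set y := z ^+ (p ^ N) in IH.
rewrite expnSr exprM -/y subrX1 absM // mulrC exprS -mulrA.
apply: ler_pM; rewrite ?abs_ge0 //.
have -> : \sum_(i < p) y ^+ i = p%:R + \sum_(i < p) (y ^+ i - 1).
  by rewrite big_split /= sumr_const card_ord mulNrn addrCA subrr addr0.
have t0 : 0 <= t by rewrite le_max abs_ge0.
apply: absD_le => //; first by rewrite le_max lexx.
apply: abs_sum_le => // i _; rewrite /y -exprM.
by apply: le_trans (absX1_le hv _ zle) _; rewrite le_max lexx orbT.
Qed.

Lemma abs_expn_pexp_small z e : v (1 - z) < 1 -> 0 < e ->
  exists N0, forall N m, (N0 <= N)%N -> (p ^ N %| m)%N -> v (z ^+ m - 1) < e.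
Proof.
move=> z1 e0; set t := Num.max (v p%:R) (v (z - 1)).
have [|N0 hN0] := @expr_small _ t e _ e0.
  by rewrite le_max abs_ge0 //= gt_max absp_lt1 absB.
exists N0 => N m /hN0 tN /dvdnP[k ->].
rewrite mulnC exprM; apply: le_lt_trans tN.
apply: le_trans (absX1_le hv _ _) _.
  by rewrite absX // exprn_ile1 ?abs_ge0 // abs_le_eq1.
apply: le_trans (abs_expn_pexp N z1) _; rewrite ler_piMr //.
  by rewrite exprn_ge0 // le_max abs_ge0.
by rewrite absB // ltW.
Qed.

(** Natural numbers that are close differ by a multiple of a high power of [p], and [q] raised to
    such a multiple is close to 1. This uniform continuity is what extends [q^k] to p-adic
    exponents. *)
Lemma expn_unif_cont q e : v (1 - q) < 1 -> 0 < e ->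
  exists2 d : R, 0 < d &
    forall a b : nat, v (a%:R - b%:R) < d -> v (q ^+ a - q ^+ b) < e.
Proof.
move=> q1 e0; have [N hN] := abs_expn_pexp_small q1 e0.
exists (v p%:R ^+ N); first by rewrite exprn_gt0 // absp_gt0.
move=> a b; wlog ba : a b / (b <= a)%N => [h|].
  have [/h//|/ltnW ab] := leqP b a.
  by rewrite absB // [X in _ -> X < _]absB //; apply: h.
rewrite -natrB // => /ltW/abs_dvdn/(hN _ _ (leqnn N)) h.
rewrite -{1}(subnK ba) exprD -{2}[q ^+ b]mul1r -mulrBl absM //.
apply: le_lt_trans h; rewrite ler_piMr ?abs_ge0 // absX //.
by rewrite exprn_ile1 ?abs_ge0 // abs_le_eq1.
Qed.

(** * Fermionic sums of a periodic function times m^k z^m *)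

Section FermionicSum.
Variables (f : nat).
Hypotheses (f_odd : odd f) (p_odd : odd p).

(** The second clause is the uniform smallness asked for by [is_regsum_integral] with
    [M N = f * p ^ N]; shifts by multiples of [f] leave the character unchanged. Boundedness makes
    the class closed under products. *)
Definition bounded_fp_cont (c : nat -> K) : Prop :=
  (exists B, forall m, v (c m) <= B) /\
  forall e, 0 < e -> exists N0, forall N, (N0 <= N)%N ->
    forall m, v (c (m + f * p ^ N)%N - c m) < e.

Lemma bounded_fp_contM c c' : bounded_fp_cont c -> bounded_fp_cont c' ->
  bounded_fp_cont (fun m => c m * c' m).
Proof.
move=> [[B cB] hc] [[B' cB'] hc'].
have B0 : 0 <= B by apply: le_trans (cB 0%N); rewrite abs_ge0.
have B'0 : 0 <= B' by apply: le_trans (cB' 0%N); rewrite abs_ge0.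
split; first by exists (B * B') => m; rewrite absM // ler_pM ?abs_ge0.
move=> e e0.
have d0 : 0 < e / (B + 1) by rewrite divr_gt0 // ltr_wpDl.
have d'0 : 0 < e / (B' + 1) by rewrite divr_gt0 // ltr_wpDl.
have [N hN] := hc _ d'0; have [N' hN'] := hc' _ d0.
exists (maxn N N') => n; rewrite geq_max => /andP[Nn N'n] m.
set m' := (m + _)%N.
have -> : c m' * c' m' - c m * c' m =
    c m' * (c' m' - c' m) + c' m * (c m' - c m) by ring.
have small (B1 : R) x y : 0 <= B1 -> v x <= B1 -> v y < e / (B1 + 1) ->
    v (x * y) < e.
  move=> B10 xB; rewrite ltr_pdivlMr ?ltr_wpDl // absM // mulrC.
  by apply: le_lt_trans; rewrite ler_wpM2r ?abs_ge0 // ler_wpDr.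
apply: absD_lt => //; [apply: small B0 _ _ | apply: small B'0 _ _] => //.
  exact: hN'.
exact: hN.
Qed.

Lemma bounded_fp_cont_periodic c :
  (forall m, c (m + f)%N = c m) -> bounded_fp_cont c.
Proof.
move=> cf; have cfk m k : c (m + f * k)%N = c m.
  by elim: k => [|k IH]; rewrite ?muln0 ?addn0 // mulnS addnCA addnC cf.
split; last by move=> e e0; exists 0%N => N _ m; rewrite cfk subrr abs0.
(* The sum of the absolute values over one period is a crude bound for each of them. *)
exists (\sum_(i < f) v (c i)) => m.
have mf : (m %% f < f)%N by rewrite ltn_mod odd_gt0.
rewrite (divn_eq m f) addnC mulnC cfk (bigD1 (Ordinal mf)) //= lerDl.
by apply: sumr_ge0 => i _; apply: abs_ge0.
Qed.

Lemma bounded_fp_cont_nat : bounded_fp_cont (fun m => m%:R).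
Proof.
split; first by exists 1 => m; apply: abs_nat.
move=> e /absp_small [N0 hN0]; exists N0 => N /hN0 h m.
rewrite natrD addrC addKr; apply: le_lt_trans h.
by apply: dvdn_abs; apply: dvdn_mull.
Qed.

Lemma bounded_fp_cont_expn z : v (1 - z) < 1 ->
  bounded_fp_cont (fun m => z ^+ m).
Proof.
move=> z1; have zX m : v (z ^+ m) <= 1.
  by rewrite absX // exprn_ile1 ?abs_ge0 // abs_le_eq1.
split; first by exists 1.
move=> e e0; have [N0 hN0] := abs_expn_pexp_small z1 e0.
exists N0 => N N0N m; have := hN0 N (f * p ^ N)%N N0N (dvdn_mull _ (dvdnn _)).
apply: le_lt_trans; rewrite exprD -{2}[z ^+ m]mulr1 -mulrBr absM //.
by rewrite ler_piMl ?abs_ge0.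
Qed.

Lemma abs_2 : v 2 = 1.
Proof. by apply: abs_coprime; rewrite coprimen2. Qed.

(** For [k = 0], a shift by the odd period [f] multiplies the sequence by [- z^f], so its series is
    geometric. Each further factor [m] comes from [X d/dX]. *)
Lemma is_regsum_char (chi : nat -> K) z k :
  (forall m, chi (m + f)%N = chi m) -> v (1 - z) < 1 ->
  exists s, is_regsum (fun m => (-1) ^+ m * (chi m * m%:R ^+ k * z ^+ m)) s.
Proof.
move=> chif z1; elim: k => [|k [s hs]]; last first.
  have [s' hs'] := is_regsum_mulrn hs; exists s'.
  by congr (is_regsum _ _): hs'; apply/funext => m; rewrite exprS; ring.
apply: (@is_regsum_geometric _ f (- z ^+ f)); first exact: odd_gt0.
  (* If [1 + z^f = 0], then [1 - z^f = 2], which has absolute value 1 since [p] is odd; but [z^f] is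
     at distance less than 1 from 1. *)
  rewrite opprK; apply/eqP => zf.
  have := abs_1unitX hv f z1.
  rewrite (_ : 1 - z ^+ f = 2 - (1 + z ^+ f)); last by ring.
  by rewrite zf subr0 abs_2 ltxx.
move=> m; rewrite chif !exprD -[(-1) ^+ f]signr_odd f_odd expr1 expr0; ring.
Qed.

(** The one-variable comparison. The factor [m^k] serves the case [q = 1], the factor [z^m] the case
    [q <> 1]; oddness of [f] and [p] makes every [f * p ^ N] odd. *)
Lemma char_fermionic_integral (chi : nat -> K) z k :
  (forall m, chi (m + f)%N = chi m) -> v (1 - z) < 1 ->
  let c m := chi m * m%:R ^+ k * z ^+ m in
  exists2 s, is_regsum (fun m => (-1) ^+ m * c m) s &
    vcvg v (fun N => \sum_(0 <= m < f * p ^ N) c m * (-1) ^+ m) (2 * s).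
Proof.
move=> chif z1 c; have [s hs] := is_regsum_char k chif z1; exists s => //.
apply: is_regsum_integral hs => //.
  by move=> N; rewrite oddM f_odd oddX p_odd orbT.
have [] // : bounded_fp_cont c.
apply: bounded_fp_contM; last exact: bounded_fp_cont_expn.
apply: bounded_fp_contM; first exact: bounded_fp_cont_periodic.
elim: k {c} => [|k IH]; first exact: bounded_fp_cont_periodic.
by under [X in bounded_fp_cont X]funext do rewrite exprS;
  apply: bounded_fp_contM => //; exact: bounded_fp_cont_nat.
Qed.

End FermionicSum.

(** Z_p as the closure of the natural numbers, the form suited to [q^x] as a limit of powers [q^k].
    It contains [padicZ] by [padicZ_int]. *)
Definition padic_int x : Prop :=
  forall e, 0 < e -> exists k : nat, v (k%:R - x) < e.

Lemma padic_int_nat k : padic_int k%:R.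
Proof. by move=> e e0; exists k; rewrite subrr abs0. Qed.

Lemma padic_int_abs x : padic_int x -> v x <= 1.
Proof.
move=> /(_ 1 ltr01)[k]; rewrite absB // => h.
exact: (abs_le1 hv (lexx 1) h (abs_nat hv k)).
Qed.

Lemma padic_intD x y : padic_int x -> padic_int y -> padic_int (x + y).
Proof.
move=> hx hy e e0; have [k hk] := hx e e0; have [l hl] := hy e e0.
by exists (k + l)%N; rewrite natrD opprD addrACA absD_lt.
Qed.

Lemma padic_intM x y : padic_int x -> padic_int y -> padic_int (x * y).
Proof.
move=> hx hy e e0; have [k hk] := hx e e0; have [l hl] := hy e e0.
exists (k * l)%N; rewrite natrM.
have -> : k%:R * l%:R - x * y = k%:R * (l%:R - y) + y * (k%:R - x) by ring.
apply: absD_lt => //; rewrite absM //.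
  by apply: le_lt_trans hl; rewrite ler_piMl ?abs_ge0 ?abs_nat.
by apply: le_lt_trans hk; rewrite ler_piMl ?abs_ge0 ?padic_int_abs.
Qed.

Lemma padic_int_sum (I : Type) (s : seq I) (P : pred I) (F : I -> K) :
  (forall i, P i -> padic_int (F i)) -> padic_int (\sum_(i <- s | P i) F i).
Proof.
move=> hF; elim/big_ind: _ => //; first exact: (padic_int_nat 0).
exact: padic_intD.
Qed.

Lemma padic_intN1 : padic_int (- 1).
Proof.
(* The natural number [p^N - 1] tends to -1. *)
move=> e /absp_small[N /(_ N (leqnn N)) hN]; exists (p ^ N).-1.
rewrite opprK natr1 prednK ?expn_gt0 ?prime_gt0 // natrX absX //.
Qed.

Lemma padic_int_int (a : int) : padic_int a%:~R.
Proof.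
case: (intP a) => [|n|n]; rewrite ?mulrNz -?pmulrn.
- exact: (padic_int_nat 0).
- exact: padic_int_nat.
by rewrite -mulN1r; apply: padic_intM; [exact: padic_intN1 | exact: padic_int_nat].
Qed.

(** A natural inverse [a] of [m] modulo [p^N] approximates [1/m]: as [|m| = 1], the error is
    [|a m - 1|]. *)
Lemma padic_intV m : coprime p m -> padic_int m%:R^-1.
Proof.
move=> pm e /absp_small[N /(_ N (leqnn N)) hN].
have m0 : (0 < m)%N by case: m pm => //; rewrite /coprime gcdn0; case: p p_prime => [|[]].
have [a b E _] := egcdnP (p ^ N) m0; exists a.
have m1 := abs_coprime pm.
have mK : m%:R != 0 :> K by apply/eqP => /(abs_eq0 hv); rewrite m1; apply/eqP/oner_neq0.
rewrite -[v _]mul1r -m1 -absM // mulrBr mulfV // -natrM mulnC E.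
rewrite (eqP (_ : coprime m (p ^ N))) 1?coprime_sym ?coprimeXl //.
rewrite natrD addrK; apply: le_lt_trans hN; apply: dvdn_abs; exact: dvdn_mull.
Qed.

(** In lowest terms [n/d], the prime [p] cannot divide [d]: it would then be prime to [n], so
    [|n| = 1], whereas [|n| = |n/d| |d| < 1]. *)
Lemma padic_int_rat (a : rat) : v (ratr a) <= 1 -> padic_int (ratr a).
Proof.
rewrite /ratr; case: (ratP a) => n d; rewrite coprime_sym => dn nd1.
apply: padic_intM; first exact: padic_int_int.
apply: padic_intV; rewrite prime_coprime //; apply/negP => pd.
have d1 : v d.+1%:R < 1.
  by apply: le_lt_trans absp_lt1; rewrite -[v p%:R]expr1 dvdn_abs // expn1.
have n1 : v n%:~R = 1.
  rewrite -(abs_coprime (coprime_dvdl pd dn)); case: (intP n) => // m.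
  by rewrite mulrNz absN // abszN.
have : v n%:~R < 1; last by rewrite n1 ltxx.
rewrite -(divfK (natr_neq0 (ltn0Sn d)) n%:~R) absM //.
by apply: le_lt_trans d1; rewrite ler_piMl ?abs_ge0.
Qed.

Lemma padicZ_int x : padicZ v x -> padic_int x.
Proof.
move=> [[u /(vcvgP _ _ hv) hu] x1] e e0.
(* Being within 1 of [x] forces the approximating rational to have absolute value at most 1. *)
have e'0 : 0 < Num.min e 1 by rewrite lt_min e0 ltr01.
have [N /(_ N (leqnn N))] := hu _ e'0.
rewrite lt_min => /andP[uNe uN1].
have [] := @padic_int_rat (u N) _ e e0.
  exact: abs_le1 (lexx 1) uN1 x1.
by move=> k hk; exists k; apply: abs_dist_lt hk uNe.
Qed.

End Padic.

(** * Powers with p-adic integer exponents *)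

Section Complete.
Variables (R : realType) (K : fieldType) (v : K -> R) (p : nat).
Hypotheses (hv : nonarch_abs v) (p_prime : prime p) (hp : v p%:R = p%:R^-1).
Hypothesis complete : forall u, vcauchy v u -> exists l, vcvg v u l.
Implicit Types (x y z q : K) (e : R).

Lemma padic_int_lim x : padic_int v x ->
  exists k : nat -> nat, vcvg v (fun i => (k i)%:R) x.
Proof.
move=> hx; have h i : exists k : nat, v (k%:R - x) < v p%:R ^+ i.
  by apply: hx; rewrite exprn_gt0 // absp_gt0.
have [k hk] := choice h; exists k; apply/(vcvgP _ _ hv) => e e0.
have [N hN] := absp_small p_prime hp e0; exists N => i /hN.
exact/lt_trans.
Qed.

Section Power.
Variable q : K.
Hypothesis q1 : v (1 - q) < 1.

Lemma qpowP x : padic_int v x -> is_qpow v q x (qpow v q x).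
Proof.
move=> /padic_int_lim[k hk].
suff [y hy] : exists y, is_qpow v q x y by exact: (xgetPex 0 (ex_intro _ y hy)).
(* For [k' = k] this says that the powers form a Cauchy sequence; for arbitrary [k'] it shows that
   the limit does not depend on the chosen sequence. *)
have close (k' : nat -> nat) e : vcvg v (fun i => (k' i)%:R) x -> 0 < e ->
    exists N, forall m n, (N <= m)%N -> (N <= n)%N ->
      v (q ^+ k' m - q ^+ k n) < e.
  move=> /(vcvgP _ _ hv) hk' e0.
  have [d d0 hd] := expn_unif_cont hv p_prime hp q1 e0.
  have [N hN] := (vcvgP _ _ hv).1 hk d d0; have [N' hN'] := hk' d d0.
  exists (maxn N N') => m n; rewrite !geq_max => /andP[_ Nm] /andP[Nn _].
  apply: hd; apply: abs_dist_lt (hN' _ Nm) _ => //.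
  by rewrite absB // hN.
have [|y hy] := complete (u := fun i => q ^+ k i).
  by move=> e e0; exact: close.
exists y => k' hk'; apply/(vcvgP _ _ hv) => e e0.
have [N hN] := close k' e hk' e0; have [N' hN'] := (vcvgP _ _ hv).1 hy e e0.
exists (maxn N N') => n; rewrite geq_max => /andP[Nn N'n].
by apply: abs_dist_lt (hN n n Nn Nn) (hN' n N'n).
Qed.

Lemma qpow_approx x e : padic_int v x -> 0 < e ->
  exists k : nat, v (k%:R - x) < e /\ v (q ^+ k - qpow v q x) < e.
Proof.
move=> hx e0; have [k hk] := padic_int_lim hx.
have [N hN] := (vcvgP _ _ hv).1 hk e e0.
have [N' hN'] := (vcvgP _ _ hv).1 (qpowP hx hk) e e0.
by exists (k (maxn N N')); rewrite hN ?hN' ?leq_maxl ?leq_maxr.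
Qed.

(** Natural exponents close to [x] have powers close to each other, so [y] is pinned down.
    Identities for [q^x] thus reduce to a single natural exponent for each [e]. *)
Lemma qpow_eq x y :
  (forall e, 0 < e -> exists k : nat, v (k%:R - x) < e /\ v (q ^+ k - y) < e) ->
  qpow v q x = y.
Proof.
move=> h; have hx : padic_int v x by move=> e /h[k []]; exists k.
apply: (abs_dist0 hv) => e e0.
have [d d0 hd] := expn_unif_cont hv p_prime hp q1 e0.
have m0 : 0 < Num.min e d by rewrite lt_min e0.
have [k []] := h _ m0; have [l []] := qpow_approx hx m0.
rewrite !lt_min => /andP[_ lx] /andP[ly _] /andP[_ kx] /andP[ky _].
rewrite absB // in ly; apply: abs_dist_lt ly _ => //.
apply: abs_dist_lt ky => //; apply: hd; apply: abs_dist_lt lx _ => //.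
by rewrite absB.
Qed.

Lemma qpow_nat m : qpow v q m%:R = q ^+ m.
Proof. by apply: qpow_eq => e e0; exists m; rewrite !subrr abs0. Qed.

Lemma qpow_1unit x : padic_int v x -> v (1 - qpow v q x) < 1.
Proof.
move=> hx; have [k [_]] := qpow_approx hx ltr01.
by apply: abs_dist_lt (abs_1unitX hv k q1).
Qed.

Lemma qpowD x y : padic_int v x -> padic_int v y ->
  qpow v q (x + y) = qpow v q x * qpow v q y.
Proof.
move=> hx hy; apply: qpow_eq => e e0.
have [k [kx kX]] := qpow_approx hx e0; have [l [ly lY]] := qpow_approx hy e0.
exists (k + l)%N; split; first by rewrite natrD opprD addrACA absD_lt.
rewrite exprD; set X := qpow v q x in kX *; set Y := qpow v q y in lY *.
have -> : q ^+ k * q ^+ l - X * Y = q ^+ k * (q ^+ l - Y) + Y * (q ^+ k - X).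
  by ring.
apply: absD_lt; rewrite ?absM //.
  apply: le_lt_trans lY; rewrite ler_piMl ?abs_ge0 // abs_le_eq1 //.
  exact: abs_1unitX.
apply: le_lt_trans kX; rewrite ler_piMl ?abs_ge0 // abs_le_eq1 //.
exact: qpow_1unit.
Qed.

Lemma qpow_sum (I : Type) (s : seq I) (F : I -> K) :
  (forall i, padic_int v (F i)) ->
  qpow v q (\sum_(i <- s) F i) = \prod_(i <- s) qpow v q (F i).
Proof.
move=> hF; elim: s => [|i s IH]; first by rewrite !big_nil (qpow_nat 0).
by rewrite !big_cons qpowD ?IH //; apply: padic_int_sum.
Qed.

Lemma qpowMn x m : padic_int v x -> qpow v q (x * m%:R) = qpow v q x ^+ m.
Proof.
move=> hx; rewrite mulr_natr -(card_ord m) -sumr_const qpow_sum //.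
by rewrite prodr_const card_ord.
Qed.

Lemma qpow_int (a : int) : qpow v q a%:~R = q ^ a.
Proof.
case: (intP a) => [|n|n]; rewrite ?mulrNz -?pmulrn.
- exact: (qpow_nat 0).
- exact: qpow_nat.
(* For a negative exponent, additivity shows that the power is inverse to [q^(n+1)], and at the same
   time that [q^(n+1)] is nonzero. *)
have := qpowD (padic_int_nat hv n.+1) (padic_int_int hv p_prime hp (- n.+1%:Z)).
rewrite mulrNz -pmulrn subrr (qpow_nat 0) qpow_nat expr0 => E.
have qn0 : q ^+ n.+1 != 0.
  by apply: contra_eq_neq E => ->; rewrite mul0r oner_neq0.
by apply: (mulfI qn0); rewrite -E; exact/esym/mulfV.
Qed.

End Power.

Lemma qpow_base1 x : padic_int v x -> qpow v 1 x = 1.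
Proof.
move=> hx; apply: qpow_eq => [|e e0]; first by rewrite subrr abs0.
by have [k kx] := hx e e0; exists k; rewrite expr1n subrr abs0.
Qed.

(** * The projection of X onto Z_p *)

Section Projection.
Variable f : nat.
Implicit Types Y : padicX f p.

(** Compatible residues at levels [N] and beyond agree modulo [p^N], so they form a Cauchy
    sequence. *)
Lemma Xval_cvg Y : exists l, vcvg v (fun N => (Xres Y N)%:R) l.
Proof.
have step N j : v ((Xres Y (N + j))%:R - (Xres Y N)%:R) <= v p%:R ^+ N.
  elim: j => [|j IH]; first by rewrite addn0 subrr abs0 // exprn_ge0 // abs_ge0.
  apply: abs_dist_le IH => //; rewrite addnS.
  rewrite [X in _ - X%:R]Xcompat {1}(divn_eq (Xres Y (N + j).+1) (f * p ^ (N + j))).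
  rewrite natrD addrK; apply: dvdn_abs => //.
  by apply/dvdn_mull/dvdn_mull/dvdn_exp2l/leq_addr.
apply: complete => e /(absp_small p_prime hp) [N /(_ N (leqnn N)) hN].
exists N => m n Nm Nn; apply: le_lt_trans hN.
apply: (@abs_dist_le _ _ _ hv (Xres Y N)%:R); last rewrite absB //.
  by rewrite -(subnKC Nm).
by rewrite -(subnKC Nn).
Qed.

Lemma padic_int_Xval Y : padic_int v (Xval v Y).
Proof.
have [l hl] := Xval_cvg Y; rewrite /Xval (vlimE hv hl) => e e0.
have [N hN] := (vcvgP _ _ hv).1 hl e e0.
by exists (Xres Y N); apply: hN.
Qed.

Lemma Xval_natX m : (0 < f)%N -> Xval v (natX f p m) = m%:R.
Proof.
move=> f0; apply: vlimE => //; apply/(vcvgP _ _ hv) => e e0.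
(* For [N >= m] one has [m < p^N <= f p^N], so the residue is [m] itself. *)
exists m => N mN /=; rewrite modn_small ?subrr ?abs0 //.
apply: leq_trans (leq_pmull _ f0); apply: leq_ltn_trans mN _.
exact/ltn_expl/prime_gt1.
Qed.

End Projection.
End Complete.

(** * Reduction to one variable *)

(** The multinomial theorem without multinomial coefficients: [h] records which summand is picked in
    each of the [n] factors, [None] standing for [x] and [Some j] for [y j]. *)
Lemma exprD_sum (K : comNzRingType) (r n : nat) (x : K) (y : 'I_r -> K) :
  (x + \sum_j y j) ^+ n = \sum_(h : {ffun 'I_n -> option 'I_r})
    x ^+ #|[pred i | h i == None]| *
      \prod_j y j ^+ #|[pred i | h i == Some j]|.
Proof.
pose z o := oapp y x o.
have -> : x + \sum_j y j = \sum_o z o.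
  rewrite (bigD1 None) //=; congr (_ + _).
  rewrite (reindex_omap Some id) /=; last by case.
  by apply: eq_bigl => j; rewrite eqxx.
rewrite -(card_ord n) -prodr_const card_ord bigA_distr_bigA.
apply: eq_bigr => h _; rewrite (partition_big h xpredT) //=.
have zc o : \prod_(i | h i == o) z (h i) = z o ^+ #|[pred i | h i == o]|.
  by rewrite -prodr_const; apply: eq_bigr => i /eqP ->.
under eq_bigr do rewrite zc.
rewrite (bigD1 None) //=; congr (_ * _).
rewrite (reindex_omap Some id) /=; last by case.
by apply: eq_bigl => j; rewrite eqxx.
Qed.

Section Tensor.
Variables (R : realType) (K : fieldType) (v : K -> R) (p f : nat).
Variables (q : K) (chi : int -> K).
Hypotheses (hv : nonarch_abs v) (p_prime : prime p) (hp : v p%:R = p%:R^-1).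
Hypothesis complete : forall u, vcauchy v u -> exists l, vcvg v u l.
Hypothesis q1 : v (1 - q) < 1.
Hypothesis f_gt0 : (0 < f)%N.
Hypothesis chi_period : forall m n : int, (m = n %[mod f])%Z -> chi m = chi n.

Lemma chiX_natX m : chiX chi (natX f p m) = chi m%:Z.
Proof.
by rewrite /chiX /= expn0 muln1; apply: chi_period; rewrite -!modz_nat modz_mod.
Qed.

(** Only the values at natural numbers are prescribed, since the sums defining the integral evaluate
    [g] nowhere else. *)
Definition char_monomial (g : padicX f p -> K) : Prop :=
  exists k z, v (1 - z) < 1 /\
    forall m, g (natX f p m) = chi m%:Z * m%:R ^+ k * z ^+ m.

Lemma E_integrand_tensor (r n : nat) (x : K) (w : 'I_r -> K) (a : 'I_r -> int) :
  padic_int v x -> (forall j, padic_int v (w j)) ->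
  exists (I : finType) (c : I -> K) (g : I -> 'I_r -> padicX f p -> K),
    (forall i j, char_monomial (g i j)) /\
    forall t, E_integrand v q chi n x w a t =
      \sum_i c i * \prod_j g i j (tnth t j).
Proof.
move=> hx hw.
have hY := padic_int_Xval hv p_prime hp complete.
have hwY j Y : padic_int v (w j * Xval v (Y : padicX f p)) by exact: padic_intM.
have haY (b : int) Y : padic_int v (b%:~R * Xval v (Y : padicX f p)).
  by apply: padic_intM => //; apply: padic_int_int hv p_prime hp b.
have [q_eq1|qn1] := eqVneq q 1.
  (* For [q = 1] the q-number is its argument and the power of [q] is 1: the multinomial expansion
     gives [chi(m) m^k] with [z = 1]. *)
  pose k (h : {ffun 'I_n -> option 'I_r}) j := #|[pred i | h i == Some j]|.
  exists {ffun 'I_n -> option 'I_r}.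
  exists (fun h : {ffun 'I_n -> option 'I_r} => x ^+ #|[pred i | h i == None]| * \prod_j w j ^+ k h j).
  exists (fun h j Y => chiX chi Y * Xval v Y ^+ k h j); split=> [h j|t].
    exists (k h j), 1; rewrite subrr abs0 //; split=> // m.
    by rewrite chiX_natX Xval_natX // expr1n mulr1.
  rewrite /E_integrand /qnum q_eq1 eqxx (qpow_base1 hv p_prime hp complete); last first.
    by apply: padic_int_sum.
  rewrite mulr1 exprD_sum mulr_suml; apply: eq_bigr => h _.
  rewrite -!mulrA -!big_split /=; congr (_ * _); apply: eq_bigr => j _.
  by rewrite -/(k h j) exprMn; ring.
have qD := qpowD hv p_prime hp complete q1.
have qS := qpow_sum hv p_prime hp complete q1.
have qMn := qpowMn hv p_prime hp complete q1.
have q1unit := qpow_1unit hv p_prime hp complete q1.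
(* For [q <> 1], the binomial expansion of [(1 - q^x prod_j q^(w_j x_j))^n / (1 - q)^n]; every power
   [q^(w_j x_j)] involves one variable only. *)
exists 'I_n.+1.
exists (fun i : 'I_n.+1 =>
  (1 - q)^-1 ^+ n * ((-1) ^+ i * 'C(n, i)%:R * qpow v q x ^+ i)).
exists (fun (i : 'I_n.+1) j Y => qpow v q (w j * Xval v Y) ^+ i * chiX chi Y *
  qpow v q ((a j)%:~R * Xval v Y)).
split=> [i j|t].
  (* On naturals the factor is [chi(m) z^m] with [z = q^(i w_j + a_j)]. *)
  exists 0%N, (qpow v q (w j) ^+ i * qpow v q (a j)%:~R).
  have aj1 := padic_int_int hv p_prime hp (a j).
  split=> [|m]; first by rewrite abs_1unitM ?abs_1unitX // q1unit.
  rewrite chiX_natX Xval_natX // !qMn // exprMn -!exprM mulnC expr0 mulr1.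
  by rewrite mulrCA mulrA.
rewrite /E_integrand /qnum (negbTE qn1) qD ?qS //; last first.
  exact: padic_int_sum.
rewrite exprMn exprBn !mulr_suml; apply: eq_bigr => i _.
rewrite expr1n mulr1 !big_split /= prodrXl exprMn -mulr_natr.
by ring.
Qed.

(** This lets one tensor expansion serve both the integral and the sum. The integer power of [q] in
    the summand is matched with the p-adic one by [qpow_int]. *)
Lemma E_summand_natX (r n : nat) (x : K) (w : 'I_r -> K) (a : 'I_r -> int)
    (m : r.-tuple nat) :
  E_summand v q chi n x w a m =
    \prod_j (-1) ^+ tnth m j *
      E_integrand v q chi n x w a (map_tuple (natX f p) m).
Proof.
rewrite /E_summand /E_integrand prodrXr.
have -> : \sum_(j < r) w j * Xval v (tnth (map_tuple (natX f p) m) j) =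
    \sum_(j < r) w j * (tnth m j)%:R.
  by apply: eq_bigr => j _; rewrite tnth_map Xval_natX.
have -> : \prod_(j < r) chiX chi (tnth (map_tuple (natX f p) m) j) =
    \prod_(j < r) chi (tnth m j)%:Z.
  by apply: eq_bigr => j _; rewrite tnth_map chiX_natX.
have -> : \sum_(j < r) (a j)%:~R * Xval v (tnth (map_tuple (natX f p) m) j) =
    (\sum_(j < r) a j * (tnth m j)%:Z)%:~R.
  rewrite rmorph_sum; apply: eq_bigr => j _.
  by rewrite tnth_map Xval_natX // rmorphM.
by rewrite (qpow_int hv p_prime hp complete q1); ring.
Qed.

Lemma char_monomial_integral g : odd f -> odd p -> char_monomial g ->
  exists2 s, is_regsum (fun m => (-1) ^+ m * g (natX f p m)) s &
    is_integralX v g (2 * s).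
Proof.
move=> f_odd p_odd [k [z [z1 gE]]].
have chif m : chi (m + f)%N%:Z = chi m%:Z.
  by apply: chi_period; rewrite PoszD modzDr.
have [s hs hI] := char_fermionic_integral hv p_prime hp f_odd p_odd k chif z1.
exists s; first by under [X in is_regsum X]funext do rewrite gE.
apply: vcvg_ext hI => N; apply: eq_bigr => m _; by rewrite gE.
Qed.

End Tensor.

(** * Comparison of the iterated integral with the iterated regularised sum *)

Theorem theorem6 (R : realType) (K : fieldType) (v : K -> R) (p f r n : nat)
    (q x : K) (chi : int -> K) (w : 'I_r -> K) (a : 'I_r -> int)
    (p_prime : prime p) (p_odd : odd p) (hK : is_Cp v p)
    (hq : v (1 - q) < 1)
    (f_odd : odd f) (hchi : dirichlet_conductor f chi)
    (r_gt0 : (0 < r)%N)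
    (hw : forall j, padicZ v (w j)) (hx : padicZ v x) :
  [/\ multi_integrableX v (E_integrand (f := f) (p := p) v q chi n x w a),
      multi_regsummable (E_summand v q chi n x w a)
    & E_chi_q v f p q chi n x w a =
        2 ^+ r * multi_regsum (E_summand v q chi n x w a)].
Proof.
have [hv hp complete _ _] := hK; have [chiP _ _ _ _] := hchi.
have f_gt0 := odd_gt0 f_odd.
have hZ := padicZ_int hv p_prime hp.
have [I [c [g [gM gE]]]] := E_integrand_tensor hv p_prime hp complete hq f_gt0
  chiP n a (hZ _ hx) (fun j => hZ _ (hw j)).
have gI i j := char_monomial_integral hv p_prime hp chiP f_odd p_odd (gM i j).
(* The sign splits over the variables, so the summand has the same tensor form and coefficients as
   the integrand. *)
have sumE : E_summand v q chi n x w a = fun m : r.-tuple nat =>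
    \sum_i c i * \prod_j ((-1) ^+ tnth m j * g i j (natX f p (tnth m j))).
  apply/funext => m; rewrite (E_summand_natX hv p_prime hp complete hq f_gt0 chiP) gE.
  rewrite mulr_sumr; apply: eq_bigr => i _; rewrite mulrCA -big_split.
  by congr (_ * _); apply: eq_bigr => j _; rewrite tnth_map.
have [|domI opI] := iter_op_tensor
    (dom := fun h => exists l, is_integralX v h l)
    (integralX_linear hv (p := p) (f := f)) c (g := g).
  by move=> i j; have [s _ hI] := gI i j; exists (2 * s).
have [|domS opS] := iter_op_tensor
    (dom := fun h => exists s, is_regsum h s) (@regsum_linear K) c
    (g := fun i j m => (-1) ^+ m * g i j (natX f p m)).
  by move=> i j; have [s hs _] := gI i j; exists s.
rewrite /E_chi_q /multi_integralX /multi_integrableX /multi_regsummable.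
rewrite /multi_regsum sumE (funext gE).
(* Term by term, each of the [r] one-variable integrals is twice the corresponding regularised sum,
   whence the factor [2^r]. *)
split=> //; rewrite opI opS mulr_sumr; apply: eq_bigr => i _.
rewrite mulrCA; congr (_ * _).
have -> : 2 ^+ r = \prod_(j < r) 2 :> K by rewrite prodr_const card_ord.
rewrite -big_split; apply: eq_bigr => j _ /=.
by have [s hs hI] := gI i j; rewrite (integralXE hv hI) (regsumE hs).
Qed.
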